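(* Let $k\geq 3$ and let $G_k$ be the graph defined below. Then (i) $\dim(G_k)=k$; (ii) the set $A$ is the unique metric basis of $G_k$; (iii) the set $\bigcup_{\emptyset\neq S\subseteq A}\{\{b_S,c_S\}\}$ is a pairing resolving set of $G_k$.
   Context: For $k\geq3$, $G_k$ is the graph with vertex set $A\cup B\cup C$, where $A,B,C$ are pairwise disjoint, $|A|=k$, and $B=\{b_S:\emptyset\neq S\subseteq A\}$, $C=\{c_S:\emptyset\neq S\subseteq A\}$ (so $|B|=|C|=2^k-1$). Edges: each of $A$, $B$, $C$ induces a clique; $b_S$ is adjacent to each vertex of $S$; $b_S$ is adjacent to $c_S$ for each nonempty $S\subseteq A$; there are no other edges. A set $W\subseteq V(G)$ is a resolving set if for all distinct $x,y$ there is $z\in W$ with $d(x,z)\neq d(y,z)$ ($d$ = shortest-path distance); $\dim(G)$ is the minimum size of a resolving set, and a metric basis is a resolving set of size $\dim(G)$. A set $\{\{u_1,w_1\},\ldots,\{u_m,w_m\}\}$ of $2$-subsets with $2m$ distinct elements in total is a pairing resolving set if every choice $\{x_1,\ldots,x_m\}$ with $x_i\in\{u_i,w_i\}$ is a resolving set. *)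

(* Defs.v *)
From mathcomp Require Import all_boot.

Set Implicit Arguments.
Unset Strict Implicit.
Unset Printing Implicit Defensive.

(* A finite simple graph is a symmetric irreflexive relation e on a finType. *)
Section MetricDimension.

Variables (T : finType) (e : rel T).

(* The least length of a path from x to y.  A shortest path has fewer than
   #|T| edges; the junk value for disconnected x, y is #|T|. *)
Definition gdist (x y : T) : nat :=
  find (fun n => [exists p : n.-tuple T, path e x p && (last x p == y)])
       (iota 0 #|T|).

Definition resolving (W : {set T}) : bool :=
  [forall x, forall y, (x != y) ==>
     [exists z in W, gdist x z != gdist y z]].

(* The whole vertex set is always resolving, so this minimum is attained. *)
Definition metric_dim : nat :=
  #|[arg min_(W < [set: T] | resolving W) #|W| ]|.

Definition metric_basis (W : {set T}) : Prop :=
  resolving W /\ #|W| = metric_dim.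

Definition pairing_resolving (P : {set {set T}}) : Prop :=
  [/\ forall p, p \in P -> #|p| = 2,
      #|cover P| = 2 * #|P| &
      forall f : {set T} -> T,
        (forall p, p \in P -> f p \in p) -> resolving (f @: P)].

Lemma gdistxx x : gdist x x = 0.
Proof.
rewrite /gdist; have: 0 < #|T| by apply/card_gt0P; exists x.
case: #|T| => // n _ /=; case: existsP => // -[]; exists [tuple]; exact: eqxx.
Qed.

Lemma gdist_le x p : path e x p -> gdist x (last x p) <= size p.
Proof.
move=> ep; rewrite leqNgt; apply/negP => lt_p.
have lt_pT: size p < #|T|.
  apply: leq_trans lt_p _; rewrite /gdist -[X in _ <= X](size_iota 0).
  exact: find_size.
have := before_find 0 lt_p; rewrite nth_iota //= add0n => /existsP; case.
by exists (in_tuple p); rewrite /= ep eqxx.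
Qed.

Lemma gdist_path x y : connect e x y ->
  exists p, [/\ path e x p, last x p = y & size p = gdist x y].
Proof.
case/connectP=> p0 ep0 ->; case/shortenP: ep0 => p ep up _.
set a := fun n => [exists q : n.-tuple T, path e x q && (last x q == last x p)].
have lt_pT: size p < #|T| by rewrite -[_ < _]/(size (x :: p) <= _) -(card_uniqP up) max_card.
have ha: has a (iota 0 #|T|).
  apply/hasP; exists (size p); first by rewrite mem_iota.
  by apply/existsP; exists (in_tuple p); rewrite /= ep eqxx.
have := nth_find 0 ha; rewrite nth_iota; last by rewrite -{2}[#|T|](size_iota 0) -has_find.
rewrite add0n => /existsP[q /andP[eq /eqP lq]].
by exists q; split=> //; rewrite size_tuple.
Qed.

Lemma resolvingT : resolving [set: T].
Proof.
apply/forallP=> x; apply/forallP=> y; apply/implyP=> neq_xy.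
case: (altP (gdist x y =P 0)) => [d0|nz]; last first.
  by apply/existsP; exists y; rewrite in_setT gdistxx.
case/eqP: neq_xy; move: d0; rewrite /gdist.
have: 0 < #|T| by apply/card_gt0P; exists x.
case: #|T| => // n _ /=; case: ifP => // /existsP[q] + _.
by rewrite [q]tuple0 /= => /eqP.
Qed.

End MetricDimension.

Section GraphG.

Variable k : nat.

Definition nesub := {S : {set 'I_k} | S != set0}.

Definition Gvert : finType := ('I_k + (nesub + nesub))%type.

Definition va (i : 'I_k) : Gvert := inl i.
Definition vb (X : nesub) : Gvert := inr (inl X).
Definition vc (X : nesub) : Gvert := inr (inr X).

Definition Gadj : rel Gvert := fun u v =>
  match u, v with
  | inl i, inl j => i != j
  | inl i, inr (inl X) => i \in val X
  | inr (inl X), inl i => i \in val X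
  | inr (inl X), inr (inl Y) => X != Y
  | inr (inl X), inr (inr Y) => X == Y
  | inr (inr X), inr (inl Y) => X == Y
  | inr (inr X), inr (inr Y) => X != Y
  | inl _, inr (inr _) => false
  | inr (inr _), inl _ => false
  end.

Lemma Gadj_sym : symmetric Gadj.
Proof. by case=> [i|[X|X]] [j|[Y|Y]] //=; rewrite eq_sym. Qed.

Lemma Gadj_irrefl : irreflexive Gadj.
Proof. by case=> [i|[X|X]] /=; rewrite eqxx. Qed.

Definition Aset : {set Gvert} := [set va i | i : 'I_k].

Definition BCpairs : {set {set Gvert}} := [set [set vb X; vc X] | X : nesub].

End GraphG.

(* Main.v *)
(** Distances in [G_k] are explicit: [d(a_i, b_S)] is 1 or 2 and [d(a_i, c_S)]
    is 2 or 3, the smaller value exactly when [i \in S]; two vertices of a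
    clique are at distance 1, and [d(b_S, c_T)] is 1 or 2 according to [S = T].
    Hence [A] recovers [S] from [b_S] and from [c_S], and could confuse [b_S]
    with [c_T] only for [S] empty.

    Conversely, let [W] be resolving with at most [k] elements, [w] of them in
    [A].  A vertex [b_S] with neither [b_S] nor [c_S] in [W] is identified by
    the trace of [S] on [W], so [2^k - 1 <= 2^w + (k - w)], which for [k >= 3]
    forces [w = k], that is [W = A].

    For the pairing, the element chosen from [{b_S, c_S}] separates [b_S] and
    [c_S] from the rest of their cliques, and [b_S] from [A]; the choice at a
    third index separates [b_S] from [c_T], at [{i}] separates [a_i] from [a_j],
    and at any [R != T] containing [i] separates [a_i] from [c_T]. *)
Require Import Defs.
From mathcomp Require Import all_boot zify.

Set Implicit Arguments.
Unset Strict Implicit.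
Unset Printing Implicit Defensive.

(** The third hypothesis lets a walk descend from [x] to [z] in exactly [d x z] steps; by the
    second, an edge lowers [d] by at most one, so no walk is shorter. *)
Lemma gdist_unique (T : finType) (e : rel T) (d : T -> T -> nat) :
    (forall x, d x x = 0) ->
    (forall x y z, e x y -> d x z <= (d y z).+1) ->
    (forall x z, x != z -> exists2 y, e x y & d x z = (d y z).+1) ->
  forall x z, gdist e x z = d x z.
Proof.
move=> d0 dL dS x z.
have [p [ep lp sp]] : exists p, [/\ path e x p, last x p = z & size p = d x z].
  move En: (d x z) => n; elim: n x En => [|n IHn] x En.
    exists [::]; split=> //=; apply/eqP/negPn/negP => /dS[y _].
    by rewrite En.
  have [|y exy Ey] := dS x z.
    by apply/eqP => xz; move: En; rewrite xz d0.
  have [|p [ep lp sp]] := IHn y; first by move: Ey; rewrite En => -[].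
  by exists (y :: p); split=> //=; [rewrite exy | rewrite sp].
apply/eqP; rewrite eqn_leq -{1}lp -sp gdist_le //= sp.
have [|q [eq lq <-]] := @gdist_path _ e x z; first by apply/connectP; exists p.
elim: q x eq lq {p ep lp sp} => [|y q IHq] x /=; first by move=> _ ->; rewrite d0.
move=> /andP[exy eyq] lq; apply: leq_trans (dL _ _ _ exy) _.
by rewrite ltnS; apply: IHq.
Qed.

Lemma resolvingP (T : finType) (e : rel T) (W : {set T}) :
  reflect (forall x y, x != y -> exists2 z, z \in W & gdist e x z != gdist e y z)
          (resolving e W).
Proof.
apply: (iffP idP) => [/forallP rW x y xy | rW].
  have /forallP/(_ y)/implyP/(_ xy)/existsP[z /andP[zW dz]] := rW x.
  by exists z.
apply/forallP=> x; apply/forallP=> y; apply/implyP=> /rW[z zW dz].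
by apply/existsP; exists z; rewrite zW.
Qed.

(** * Distances in [G_k] *)

Section GraphDistance.

Variable k : nat.
Implicit Types (i j : 'I_k) (X Y Z : nesub k) (u v : Gvert k).

Definition Gdist u v : nat :=
  match u, v with
  | inl i, inl j => i != j
  | inl i, inr (inl X) | inr (inl X), inl i => 2 - (i \in val X)
  | inl i, inr (inr X) | inr (inr X), inl i => 3 - (i \in val X)
  | inr (inl X), inr (inl Y) | inr (inr X), inr (inr Y) => X != Y
  | inr (inl X), inr (inr Y) | inr (inr X), inr (inl Y) => (X != Y).+1
  end.

Lemma gdistE : gdist (@Gadj k) =2 Gdist.
Proof.
apply: gdist_unique.
- by case=> [i|[X|X]] /=; rewrite eqxx.
- case=> [i|[X|X]] [j|[Y|Y]] [l|[Z|Z]] //= adj.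
  all: try by do ?[case: (_ \in _) | case: (_ != _)].
  all: try by rewrite (eqP adj); do ?[case: (_ \in _) | case: (_ != _)].
  (* Left are edges between [A] and [B]; when the two indices compared agree, the bound relies on
     the membership [adj]. *)
  + by have [<-|_] := eqVneq Y Z; rewrite ?adj //; case: (_ \in _).
  + by have [<-|_] := eqVneq Y Z; rewrite ?adj //; case: (_ \in _).
  + by have [<-|_] := eqVneq j l; rewrite ?adj //; case: (_ \in _).
- case=> [i|[X|X]] [j|[Y|Y]] //= xz.
  + by exists (va j) => /=; [| rewrite eqxx xz].
  + have [iY|iY] := boolP (i \in val Y).
      by exists (vb Y) => //=; rewrite eqxx.
    (* [Y] is nonempty, so one step inside [A] reaches a neighbour of [vb Y]. *)
    have /set0Pn[j jY] := valP Y; exists (va j) => /=; last by rewrite jY.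
    by apply: contraNneq iY => ->.
  + have [iY|iY] := boolP (i \in val Y).
      by exists (vb Y) => //=; rewrite eqxx.
    have /set0Pn[j jY] := valP Y; exists (va j) => /=; last by rewrite jY.
    by apply: contraNneq iY => ->.
  + have [jX|jX] := boolP (j \in val X).
      by exists (va j) => //=; rewrite eqxx.
    have /set0Pn[l lX] := valP X; exists (va l) => //=.
    by have -> : l != j by apply: contraNneq jX => <-.
  + have XY : X != Y by apply: contraNneq xz => ->.
    by exists (vb Y); rewrite //= eqxx XY.
  + have [<-|XY] := eqVneq X Y; first by exists (vc X); rewrite /= eqxx.
    by exists (vb Y); rewrite /= ?eqxx.
  + by exists (vb X); rewrite /= ?eqxx //; case: (_ \in _).
  + have [<-|XY] := eqVneq X Y; first by exists (vb X); rewrite /= eqxx.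
    by exists (vc Y); rewrite /= ?eqxx.
  + have XY : X != Y by apply: contraNneq xz => ->.
    by exists (vc Y); rewrite //= eqxx XY.
Qed.

(** * Dimension and uniqueness of the basis *)

Lemma va_inj : injective (@va k). Proof. by move=> i j []. Qed.

Lemma card_Aset : #|Aset k| = k.
Proof. by rewrite card_imset ?card_ord //; apply: va_inj. Qed.

Lemma card_nesub : #|{: nesub k}| = (2 ^ k).-1.
Proof. by rewrite card_sig (cardC1 set0) -cardsT -powersetT card_powerset cardsT card_ord. Qed.

Lemma nesub_separated X Y : X != Y ->
  exists i, (i \in val X) != (i \in val Y).
Proof.
move=> XY; apply/existsP; apply: contraNT XY => /existsPn h.
by apply/eqP/val_inj/setP => i; apply/eqP/negPn/h.
Qed.

Lemma resolving_Aset : resolving (@Gadj k) (Aset k).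
Proof.
apply/resolvingP => x y.
suff [i di] : exists i, x != y -> Gdist x (va i) != Gdist y (va i).
  by move=> /di dxy; exists (va i); rewrite ?imset_f // !gdistE.
case: x y => [i|[X|X]] [j|[Y|Y]].
- exists i => ij; have {}ij : j != i by apply: contraNneq ij => ->.
  by rewrite /= eqxx ij.
- by exists i => /= _; rewrite eqxx; case: (_ \in _).
- by exists i => /= _; rewrite eqxx; case: (_ \in _).
- by exists j => /= _; rewrite eqxx; case: (_ \in _).
- have [<-|/nesub_separated[i iXY]] := eqVneq X Y.
    by have /set0Pn[i _] := valP X; exists i; rewrite eqxx.
  by exists i => _ /=; move: iXY; do 2!case: (_ \in _).
(* Any [i] in [X] puts [vb X] at distance 1 from [va i], while [vc Y] is at distance at least 2. *)
- have /set0Pn[i iX] := valP X.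
  by exists i => _ /=; rewrite iX; case: (_ \in _).
- by exists j => /= _; rewrite eqxx; case: (_ \in _).
- have /set0Pn[i iY] := valP Y.
  by exists i => _ /=; rewrite iY; case: (_ \in _).
- have [<-|/nesub_separated[i iXY]] := eqVneq X Y.
    by have /set0Pn[i _] := valP X; exists i; rewrite eqxx.
  by exists i => _ /=; move: iXY; do 2!case: (_ \in _).
Qed.

(** The inequality reads [2^w * (2^m - 1) <= m + 1]. Its only solutions [(w, m)] with [m > 0] are
    [(0, 1)], [(0, 2)] and [(1, 1)], all with sum below 3. *)
Lemma expn2_sub1_bound w m : 3 <= w + m -> (2 ^ (w + m)).-1 <= 2 ^ w + m -> m = 0.
Proof.
case: m => // m k3; rewrite expnD expnS.
have m2 : m < 2 ^ m by apply: ltn_expl.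
have w2 : w < 2 ^ w by apply: ltn_expl.
case: w k3 w2 => [|[|w]]; rewrite ?expnS ?expn0.
- case: m m2 => [|[|m]] //; rewrite ?expnS; have := ltn_expl m (isT : 1 < 2).
  lia.
- case: m m2 => [|m] //; rewrite ?expnS; have := ltn_expl m (isT : 1 < 2).
  lia.
have := ltn_expl w (isT : 1 < 2); nia.
Qed.

Lemma card_resolving_bound (W : {set Gvert k}) : resolving (@Gadj k) W ->
  (2 ^ k).-1 <= 2 ^ #|W :&: Aset k| + #|W :\: Aset k|.
Proof.
move=> /resolvingP rW; rewrite -card_nesub -cardsT.
pose N := [set X | (vb X \in W) || (vc X \in W)].
pose D := [set i | va i \in W].
have cD : #|W :&: Aset k| = #|D|.
  rewrite -(card_imset _ va_inj); apply: eq_card => u; rewrite inE.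
  apply/andP/imsetP => [[uW /imsetP[i _ Eu]]|[i]].
    by exists i; rewrite // inE -Eu.
  by rewrite inE => iW ->; rewrite iW imset_f.
have cN : #|N| <= #|W :\: Aset k|.
  pose g X := if vb X \in W then vb X else vc X.
  have g_inj : injective g.
    by move=> X Y; rewrite /g; case: ifP; case: ifP => // _ _ [].
  rewrite -(card_imset _ g_inj); apply/subset_leq_card/subsetP => u /imsetP[X].
  rewrite inE /g => XN ->; rewrite inE; case: ifP XN => /= [-> _|_ ->];
    by rewrite andbT; apply/imsetP => -[].
have cNC : #|~: N| <= 2 ^ #|D|.
  rewrite -card_powerset -(card_in_imset (f := fun X => val X :&: D)).
    by apply/subset_leq_card/subsetP => S /imsetP[X _ ->]; rewrite inE subsetIr.
  move=> X Y; rewrite !inE !negb_or => /andP[bX cX] /andP[bY cY] XY.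
  apply/eqP/negPn/negP => nXY.
  (* A [vb Z] or [vc Z] in [W] has index other than [X] and [Y], so it is equidistant from [vb X]
     and [vb Y]; vertices of [A] in [W] fail too, as the traces on [D] agree. *)
  have [|z zW] := rW (vb X) (vb Y); first by apply: contraNneq nXY => -[->].
  rewrite !gdistE; case: z zW => [i|[Z|Z]] zW /=.
  - have iD : i \in D by rewrite inE.
    have /setP/(_ i) := XY; rewrite !in_setI iD !andbT => ->.
    by rewrite eqxx.
  - have -> : X != Z by apply: contraNneq bX => ->.
    by have -> : Y != Z by apply: contraNneq bY => ->.
  - have -> : X != Z by apply: contraNneq cX => ->.
    by have -> : Y != Z by apply: contraNneq cY => ->.
by rewrite cD cardsT -(cardsC N) addnC leq_add.
Qed.

(** Allowing size at most [k] makes this serve both the lower bound on the dimension and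
    uniqueness. *)
Lemma resolving_card_le (W : {set Gvert k}) :
  3 <= k -> resolving (@Gadj k) W -> #|W| <= k -> W = Aset k.
Proof.
move=> k3 /card_resolving_bound bW cW.
have cWA := cardsID (Aset k) W.
have w_le : #|W :&: Aset k| <= k.
  by rewrite -[leqRHS]card_Aset subset_leq_card ?subsetIr.
have Ek := subnKC w_le.
(* This difference bounds the number of elements of [W] outside [A]. *)
have m0 : k - #|W :&: Aset k| = 0.
  apply: (@expn2_sub1_bound #|W :&: Aset k|); rewrite Ek //.
  by apply: leq_trans bW _; rewrite leq_add2l; lia.
apply/esym/eqP; rewrite eqEcard card_Aset cW andbT.
by apply/setIidPr/eqP; rewrite eqEcard subsetIr card_Aset; lia.
Qed.

Lemma metric_dimE : 3 <= k -> metric_dim (@Gadj k) = k.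
Proof.
move=> k3; rewrite /metric_dim; case: arg_minnP => [|W rW minW].
  exact: resolvingT.
rewrite (resolving_card_le k3 rW) ?card_Aset //.
by rewrite -[leqRHS]card_Aset minW ?resolving_Aset.
Qed.

(** * The pairing resolving set *)

Definition bcpair X : {set Gvert k} := [set vb X; vc X].

Lemma card_bcpair X : #|bcpair X| = 2.
Proof. by rewrite cards2. Qed.

Lemma trivIset_BCpairs : trivIset (BCpairs k).
Proof.
apply/trivIsetP => _ _ /imsetP[X _ ->] /imsetP[Y _ ->] nXY.
rewrite -setI_eq0; apply/eqP/setP => u; rewrite !inE; apply/negP => /andP[].
by move=> /orP[]/eqP-> /orP[]/eqP // [EXY]; rewrite EXY eqxx in nXY.
Qed.

Lemma card_cover_BCpairs : #|cover (BCpairs k)| = 2 * #|BCpairs k|.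
Proof.
have /eqP <- := trivIset_BCpairs.
rewrite (eq_bigr (fun=> 2)) ?sum_nat_const ?(mulnC 2) // => _ /imsetP[X _ ->].
exact: card_bcpair.
Qed.

Lemma exists_nesub_neq2 X Y : 3 <= k -> exists2 Z : nesub k, X != Z & Y != Z.
Proof.
move=> k3; have : 0 < #|~: [set X; Y]|.
  have := cardsC [set X; Y]; rewrite card_nesub cards2.
  (* At least [2^3 - 1 = 7] indices exist, and at most two are excluded. *)
  by have := leq_pexp2l (isT : 0 < 2) k3; case: (X != Y); lia.
by case/card_gt0P => Z; rewrite !inE negb_or ![Z == _]eq_sym => /andP[]; exists Z.
Qed.

Lemma singleton_neq0 i : [set i] != set0.
Proof. by apply/set0Pn; exists i; rewrite inE. Qed.

Definition nesub1 i : nesub k := Sub [set i] (singleton_neq0 i).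

(** The full set and [{i}] both contain [i] and differ in size, so [X] is at most one of them. *)
Lemma exists_nesub_mem_neq i X : 3 <= k -> exists2 Z : nesub k, i \in val Z & X != Z.
Proof.
move=> k3; have nT : [set: 'I_k] != set0 by apply/set0Pn; exists i; rewrite inE.
have [EX|nX] := eqVneq X (Sub [set: 'I_k] nT); last first.
  by exists (Sub [set: 'I_k] nT : nesub k); rewrite ?SubK ?inE.
exists (nesub1 i); first by rewrite SubK inE.
rewrite EX; apply/eqP => /(congr1 (fun Z : nesub k => #|val Z|)).
by rewrite !SubK cards1 cardsT card_ord; lia.
Qed.

Lemma resolving_choice (g : nesub k -> Gvert k) : 3 <= k ->
  (forall X, g X = vb X \/ g X = vc X) -> resolving (@Gadj k) [set g X | X : nesub k].
Proof.
move=> k3 gP; apply/resolvingP => x y.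
suff [Z dZ] : exists Z, x != y -> Gdist x (g Z) != Gdist y (g Z).
  by move=> /dZ dxy; exists (g Z); rewrite ?imset_f // !gdistE.
have ac i Y : exists Z, Gdist (va i) (g Z) != Gdist (vc Y) (g Z).
  have [Z iZ ZY] := exists_nesub_mem_neq i Y k3.
  (* The distances are 1 against 2 if [g Z] is [vb Z], and 2 against 1 if it is [vc Z]. *)
  by exists Z; case: (gP Z) => -> /=; rewrite iZ ZY.
have ab i Y : exists Z, Gdist (va i) (g Z) != Gdist (vb Y) (g Z).
  by exists Y; case: (gP Y) => -> /=; rewrite eqxx; case: (_ \in _).
have bc X Y : exists Z, Gdist (vb X) (g Z) != Gdist (vc Y) (g Z).
  have [Z ZX ZY] := exists_nesub_neq2 X Y k3.
  by exists Z; case: (gP Z) => -> /=; rewrite ZX ZY.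
case: x y => [i|[X|X]] [j|[Y|Y]].
- exists (nesub1 i) => ij.
  have {}ij : (j == i) = false.
    by apply/negbTE; apply: contraNneq ij => ->.
  by case: (gP (nesub1 i)) => -> /=; rewrite !inE eqxx ij.
- by have [Z dZ] := ab i Y; exists Z.
- by have [Z dZ] := ac i Y; exists Z.
- by have [Z dZ] := ab j X; exists Z => _; rewrite eq_sym.
- exists X => XY; have {}XY : Y != X by apply: contraNneq XY => ->.
  by case: (gP X) => -> /=; rewrite eqxx XY.
- by have [Z dZ] := bc X Y; exists Z.
- by have [Z dZ] := ac j X; exists Z => _; rewrite eq_sym.
- by have [Z dZ] := bc Y X; exists Z => _; rewrite eq_sym.
- exists X => XY; have {}XY : Y != X by apply: contraNneq XY => ->.
  by case: (gP X) => -> /=; rewrite eqxx XY.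
Qed.

Lemma pairing_resolving_BCpairs : 3 <= k -> pairing_resolving (@Gadj k) (BCpairs k).
Proof.
move=> k3; split=> [_ /imsetP[X _ ->]||f fP]; first exact: card_bcpair.
  exact: card_cover_BCpairs.
have -> : f @: BCpairs k = [set f (bcpair X) | X : nesub k].
  by rewrite -imset_comp.
apply: resolving_choice => // X.
have /fP : bcpair X \in BCpairs k by apply: imset_f.
by case/set2P => ->; [left | right].
Qed.

End GraphDistance.

Theorem theorem3p6 (k : nat) (hk : 3 <= k) :
  [/\ metric_dim (@Gadj k) = k,
      metric_basis (@Gadj k) (Aset k) /\
        (forall W : {set Gvert k}, metric_basis (@Gadj k) W -> W = Aset k) &
      pairing_resolving (@Gadj k) (BCpairs k)].
Proof.
split; [exact: metric_dimE | | exact: pairing_resolving_BCpairs].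
split; first by split; [exact: resolving_Aset | rewrite metric_dimE ?card_Aset].
by move=> W [rW cW]; apply: resolving_card_le => //; rewrite cW metric_dimE.
Qed.
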